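(* $$\sum_{k=0}^{\infty}\frac{\binom{2k}{k}^5}{(-2^{12})^k}\Big\{5(20k^2+8k+1)H_{2k}-10k-1\Big\}=-\frac{32\log 2}{\pi^2}.$$
   Context: For a nonnegative integer $n$, $H_n=\sum_{j=1}^{n}\frac{1}{j}$ denotes the classical harmonic number, with $H_0=0$. $\log$ is the natural logarithm. *)

(* Defs.v *)
From Stdlib Require Import Reals.
From Coquelicot Require Import Coquelicot.

Open Scope R_scope.

(* [sum_n_m] is the empty sum, i.e. 0, for n = 0 (Stdlib's [sum_f 1 0] is not). *)
Definition harmonic (n : nat) : R := sum_n_m (fun j : nat => 1 / INR j) 1 n.

(* Main.v *)
Require Import Defs.
From Stdlib Require Import Reals Factorial Lra Lia.
From Coquelicot Require Import Coquelicot.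

Open Scope R_scope.

(** Up to a constant multiple of the Guillera series
    sum binom(2n,n)^5 (20n^2+8n+1) / (-2^12)^n = 8 / PI^2, the series is the
    derivative at x = 0 of a one-parameter deformation of that Guillera series.
    Write (a)_n for the rising factorial and put
<<
      h_x(n,k) = (-1)^n Gamma(n+k+1/2)^3 (1/2+x)_n^3 Gamma(k+1/2-2x)
                 / (PI^2 Gamma(n+k+1-x)^3 n! Gamma(2n+k+2+x)),
      q_x(n,k) = n (2n+k+1+x) (2n+2k+1/2-x),
      F_x = h_x q_x,       G_x = h_x ((n+k+1/2)^3 + q_x).
>>
    These form a Wilf-Zeilberger pair for every x:
    G_x(n,k+1) - G_x(n,k) = F_x(n+1,k) - F_x(n,k), with F_x(0,k) = 0.  (Summed
    over n it expresses the invariance in k of the series that accelerates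
    Dougall's 5F4 sum with a = 1/2-2x+k and b = c = d = 1/2-x.)  The relation is
    linear in the pair and holds identically in x, so the x-derivatives at 0 of
    F_x and G_x satisfy it too.  The logarithmic derivative of h_x at 0 is a
    combination of harmonic numbers plus the constant 4 ln 2; since (F_0,G_0) is
    itself such a pair, the constant can be dropped.  What is left is the pair
    [wzF], [wzG], made of rational numbers only, and the pair relation
    [wz_equation] is checked directly from the one-step recurrences of its
    factors.

    For k = 0 the harmonic numbers collapse to 5 H_(2n) and 8 [wzG n 0] is the
    summand of the theorem ([summand_eq_wzG]).  Terms with n >= 1 are bounded by
    a geometric sequence times 1/(k+1) ([wzG_le], [wzF_le]); hence sum_n [wzG n k]
    does not depend on k ([Series_wzG_S]) and equals the limit of [wzG 0 k] as k
    grows ([Series_wzG_near_0]).  That limit is elementary ([wzG_0_lim]):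
    [wzG 0 k] behaves like -4 (H_(2k) - H_k) ((k+1/2) (binom(2k,k)/4^k)^2)^2,
    where H_(2k) - H_k tends to ln 2 and, by Wallis' formula,
    (k+1/2) (binom(2k,k)/4^k)^2 tends to 1/PI. *)

(** * Harmonic numbers *)

Lemma harmonic_0 : harmonic 0 = 0.
Proof. unfold harmonic. rewrite sum_n_m_zero by lia. reflexivity. Qed.

Lemma harmonic_S (n : nat) : harmonic (S n) = harmonic n + 1 / (INR n + 1).
Proof.
  unfold harmonic. rewrite sum_n_Sm by lia. rewrite S_INR. reflexivity.
Qed.

Lemma harmonic_bounds (n : nat) : 0 <= harmonic n <= INR n.
Proof.
  induction n as [|n IH].
  - rewrite harmonic_0. simpl. lra.
  - rewrite harmonic_S, S_INR. pose proof (pos_INR n) as Hn.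
    assert (0 < 1 / (INR n + 1) <= 1).
    { split; [apply Rdiv_lt_0_compat; lra|].
      apply <- Rle_div_l; lra. }
    lra.
Qed.

Lemma ln_le_sub_1 (x : R) : 0 < x -> ln x <= x - 1.
Proof.
  intros Hx. pose proof (exp_ineq1_le (ln x)) as H.
  rewrite exp_ln in H; lra.
Qed.

Lemma inv_bounds_ln (x : R) :
  0 < x -> ln (x + 1) - ln x <= 1 / x /\ 1 / (x + 1) <= ln (x + 1) - ln x.
Proof.
  intros Hx. split.
  - rewrite <- ln_div by lra.
    eapply Rle_trans; [apply ln_le_sub_1; apply Rdiv_lt_0_compat; lra|].
    right; field; lra.
  - assert (H : ln (x / (x + 1)) <= x / (x + 1) - 1).
    { apply ln_le_sub_1; apply Rdiv_lt_0_compat; lra. }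
    rewrite ln_div in H by lra.
    replace (x / (x + 1) - 1) with (- (1 / (x + 1))) in H by (field; lra).
    lra.
Qed.

(** Comparison of the sum of 1/j with the integral of 1/t, one unit interval
    at a time. *)
Lemma harmonic_diff_bounds (m d : nat) :
  ln (INR (m + d) + 1) - ln (INR m + 1) <= harmonic (m + d) - harmonic m /\
  ((0 < m)%nat ->
   harmonic (m + d) - harmonic m <= ln (INR (m + d)) - ln (INR m)).
Proof.
  induction d as [|d IH].
  - rewrite Nat.add_0_r. split; intros; lra.
  - rewrite Nat.add_succ_r, harmonic_S, S_INR.
    pose proof (pos_INR (m + d)) as Hp. destruct IH as [IH1 IH2]. split.
    + destruct (inv_bounds_ln (INR (m + d) + 1)) as [H _]; lra.
    + intros Hm. specialize (IH2 Hm).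
      assert (0 < INR (m + d)) by (apply lt_0_INR; lia).
      destruct (inv_bounds_ln (INR (m + d))) as [_ H0]; lra.
Qed.

Lemma is_lim_seq_const_div_S (c : R) :
  is_lim_seq (fun n => c / (INR n + 1)) 0.
Proof.
  apply is_lim_seq_ext with (fun n => c * / INR (S n)).
  { intros n. rewrite S_INR. reflexivity. }
  replace (Finite 0) with (Rbar_mult c 0) by (simpl; f_equal; ring).
  apply is_lim_seq_scal_l.
  apply (is_lim_seq_incr_1 (fun n => / INR n)).
  replace (Finite 0) with (Rbar_inv p_infty) by reflexivity.
  apply is_lim_seq_inv; [apply is_lim_seq_INR|discriminate].
Qed.

Lemma harmonic_2n_sub_n_lim :
  is_lim_seq (fun n => harmonic (2 * n) - harmonic n) (ln 2).
Proof.
  apply is_lim_seq_le_le_loc with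
    (u := fun n => ln 2 - 1 / (INR n + 1)) (w := fun _ => ln 2).
  - exists 1%nat. intros n Hn.
    replace (2 * n)%nat with (n + n)%nat by lia.
    destruct (harmonic_diff_bounds n n) as [H1 H2].
    specialize (H2 Hn). rewrite plus_INR in *.
    assert (Hp : 1 <= INR n) by (change 1 with (INR 1); apply le_INR; lia).
    split.
    + destruct (inv_bounds_ln (INR n + INR n + 1)) as [H _]; [lra|].
      replace (INR n + INR n + 1 + 1) with (2 * (INR n + 1)) in H by ring.
      rewrite ln_mult in H by lra.
      assert (1 / (INR n + INR n + 1) <= 1 / (INR n + 1)).
      { apply Rmult_le_compat_l; [lra|]. apply Rinv_le_contravar; lra. }
      lra.
    + replace (INR n + INR n) with (2 * INR n) in H2 by ring.
      rewrite ln_mult in H2 by lra. lra.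
  - replace (Finite (ln 2)) with (Finite (ln 2 - 0)) by (f_equal; ring).
    apply is_lim_seq_minus'; [apply is_lim_seq_const|].
    apply is_lim_seq_const_div_S.
  - apply is_lim_seq_const.
Qed.

(** * Normalised central binomial coefficients and Wallis' formula *)

Definition cbin (n : nat) : R := Binomial.C (2 * n) n / 4 ^ n.

Lemma cbin_0 : cbin 0 = 1.
Proof. unfold cbin, Binomial.C. simpl. field. Qed.

Lemma cbin_S (n : nat) :
  cbin (S n) = cbin n * ((2 * INR n + 1) / (2 * INR n + 2)).
Proof.
  unfold cbin, Binomial.C.
  replace (2 * S n - S n)%nat with (S n) by lia.
  replace (2 * n - n)%nat with n by lia.
  replace (2 * S n)%nat with (S (S (2 * n))) by lia.
  rewrite !fact_simpl, !mult_INR, !S_INR, mult_INR.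
  change (INR 2) with 2. simpl pow.
  pose proof (pos_INR n). pose proof (INR_fact_neq_0 n).
  pose proof (pow_nonzero 4 n). field.
  repeat split; try lra; auto with real.
Qed.

Lemma cbin_pos (n : nat) : 0 < cbin n.
Proof.
  induction n as [|n IH]; [rewrite cbin_0; lra|].
  rewrite cbin_S. pose proof (pos_INR n).
  apply Rmult_lt_0_compat; [assumption|]. apply Rdiv_lt_0_compat; lra.
Qed.

Lemma cbin_S_le (n : nat) : cbin (S n) <= cbin n.
Proof.
  rewrite cbin_S. pose proof (pos_INR n). pose proof (cbin_pos n).
  rewrite <- (Rmult_1_r (cbin n)) at 2.
  apply Rmult_le_compat_l; [lra|]. apply <- Rle_div_l; lra.
Qed.

Lemma cbin_add_le (m d : nat) : cbin (m + d) <= cbin m.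
Proof.
  induction d as [|d IH]; [rewrite Nat.add_0_r; lra|].
  rewrite Nat.add_succ_r. pose proof (cbin_S_le (m + d)). lra.
Qed.

(** The factor 1/(2n+1) is inductive because (2n+1)(2n+3) <= (2n+2)^2. *)
Lemma cbin_sq_le (n : nat) : cbin n ^ 2 <= 1 / (2 * INR n + 1).
Proof.
  induction n as [|n IH]; [rewrite cbin_0; simpl; lra|].
  rewrite cbin_S, S_INR. pose proof (pos_INR n) as Hn.
  rewrite Rpow_mult_distr.
  eapply Rle_trans; [apply Rmult_le_compat_r; [apply pow2_ge_0|exact IH]|].
  apply -> Rle_div_r; [|lra].
  replace (1 / (2 * INR n + 1) * ((2 * INR n + 1) / (2 * INR n + 2)) ^ 2 *
           (2 * (INR n + 1) + 1))
    with ((2 * INR n + 1) * (2 * INR n + 3) / (2 * INR n + 2) ^ 2)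
    by (field; lra).
  apply <- Rle_div_l; nra.
Qed.

Definition wallis (n : nat) : R := RInt (fun t => sin t ^ n) 0 (PI / 2).

Lemma ex_RInt_sin_pow (n : nat) : ex_RInt (fun t => sin t ^ n) 0 (PI / 2).
Proof.
  apply (ex_RInt_continuous (V := R_CompleteNormedModule)). intros t _.
  apply (ex_derive_continuous (fun t => sin t ^ n)). auto_derive. trivial.
Qed.

(** Integrates the derivative of sin^(n+1) cos, which vanishes at both ends. *)
Lemma wallis_SS (n : nat) :
  (INR n + 2) * wallis (S (S n)) = (INR n + 1) * wallis n.
Proof.
  assert (H : is_RInt (fun t => (INR n + 1) * sin t ^ n
                                - (INR n + 2) * sin t ^ S (S n))
                0 (PI / 2)
                (minus (sin (PI / 2) ^ S n * cos (PI / 2))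
                       (sin 0 ^ S n * cos 0))).
  { apply (is_RInt_derive (fun t => sin t ^ S n * cos t)).
    - intros t _. auto_derive; [trivial|].
      change (match n with 0%nat => 1 | S _ => INR n + 1 end) with (INR (S n)).
      rewrite S_INR. simpl pow.
      pose proof (sin2_cos2 t) as E. unfold Rsqr in E.
      transitivity ((INR n + 1) * sin t ^ n * (cos t * cos t)
                    - sin t * sin t * sin t ^ n); [ring|].
      replace (cos t * cos t) with (1 - sin t * sin t) by lra. ring.
    - intros t _.
      apply (ex_derive_continuous (fun t => (INR n + 1) * sin t ^ n
                                - (INR n + 2) * sin t ^ S (S n))).
      auto_derive. trivial. }
  assert (H2 : is_RInt (fun t => (INR n + 1) * sin t ^ n
                                - (INR n + 2) * sin t ^ S (S n))
                0 (PI / 2)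
                (minus (scal (INR n + 1) (wallis n))
                       (scal (INR n + 2) (wallis (S (S n)))))).
  { apply (is_RInt_minus (V := R_NormedModule)
             (fun t => scal (INR n + 1) (sin t ^ n))
             (fun t => scal (INR n + 2) (sin t ^ S (S n))));
      apply (is_RInt_scal (V := R_NormedModule));
      apply (RInt_correct (V := R_CompleteNormedModule)), ex_RInt_sin_pow. }
  pose proof (is_RInt_unique (V := R_CompleteNormedModule) _ _ _ _ H) as E1.
  pose proof (is_RInt_unique (V := R_CompleteNormedModule) _ _ _ _ H2) as E2.
  rewrite E1 in E2. clear E1.
  rewrite cos_PI2, sin_0 in E2.
  unfold minus, plus, opp, scal in E2; simpl in E2.
  unfold mult in E2; simpl in E2. lra.
Qed.

Lemma wallis_S_le (n : nat) : wallis (S n) <= wallis n.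
Proof.
  pose proof PI_RGT_0.
  apply RInt_le; try apply ex_RInt_sin_pow; [lra|].
  intros t Ht. simpl.
  assert (0 <= sin t) by (apply sin_ge_0; lra).
  pose proof (SIN_bound t).
  rewrite <- (Rmult_1_l (sin t ^ n)) at 2.
  apply Rmult_le_compat_r; [apply pow_le; assumption|lra].
Qed.

Lemma wallis_even (n : nat) : wallis (2 * n) = cbin n * (PI / 2).
Proof.
  induction n as [|n IH].
  - rewrite cbin_0. unfold wallis. simpl.
    rewrite RInt_const. unfold scal; simpl; unfold mult; simpl. lra.
  - replace (2 * S n)%nat with (S (S (2 * n))) by lia.
    pose proof (wallis_SS (2 * n)) as H. rewrite IH, mult_INR in H.
    change (INR 2) with 2 in H. pose proof (pos_INR n).
    apply Rmult_eq_reg_l with (2 * INR n + 2); [|lra].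
    rewrite H, cbin_S. field. lra.
Qed.

Lemma wallis_odd (n : nat) : wallis (S (2 * n)) = 1 / ((2 * INR n + 1) * cbin n).
Proof.
  induction n as [|n IH].
  - rewrite cbin_0. unfold wallis.
    rewrite (RInt_ext _ sin) by (intros; simpl; ring).
    assert (H : is_RInt sin 0 (PI / 2) (minus (- cos (PI / 2)) (- cos 0))).
    { apply (is_RInt_derive (fun t => - cos t)).
      - intros t _. auto_derive; [trivial|ring].
      - intros t _. apply (ex_derive_continuous sin). auto_derive. trivial. }
    rewrite (is_RInt_unique (V := R_CompleteNormedModule) _ _ _ _ H).
    rewrite cos_PI2, cos_0. unfold minus, plus, opp; simpl. field.
  - replace (2 * S n)%nat with (S (S (2 * n))) by lia.
    pose proof (wallis_SS (S (2 * n))) as H.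
    rewrite IH, !S_INR, mult_INR in H.
    change (INR 2) with 2 in H. pose proof (pos_INR n). pose proof (cbin_pos n).
    rewrite S_INR, cbin_S.
    apply Rmult_eq_reg_l with (2 * INR n + 1 + 2); [|lra].
    rewrite H. field. lra.
Qed.

(** Wallis' formula with an error term: the even and odd integrals are
    [cbin n * (PI / 2)] and [1 / ((2n+1) * cbin n)], and they interlace. *)
Lemma cbin_sq_bounds (n : nat) :
  1 / PI <= (INR n + 1 / 2) * cbin n ^ 2 <= 1 / PI + 1 / (INR n + 1).
Proof.
  pose proof PI_RGT_0 as HPI. pose proof (cbin_pos n) as Hc.
  pose proof (pos_INR n) as Hn. split.
  - pose proof (wallis_S_le (2 * n)) as H.
    rewrite wallis_odd, wallis_even in H.
    apply -> Rle_div_l in H; [|apply Rmult_lt_0_compat; lra].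
    apply <- Rle_div_l; [|lra]. nra.
  - assert (Hm : INR n * cbin n ^ 2 <= 1 / PI).
    { destruct n as [|n].
      - simpl INR. rewrite Rmult_0_l. apply Rlt_le, Rdiv_lt_0_compat; lra.
      - pose proof (wallis_S_le (S (2 * n))) as H.
        replace (S (S (2 * n))) with (2 * S n)%nat in H by lia.
        rewrite wallis_odd, wallis_even in H.
        rewrite S_INR in *. pose proof (pos_INR n). pose proof (cbin_pos n).
        apply (Rle_div_r (cbin (S n) * (PI / 2)) 1) in H;
          [|apply Rmult_lt_0_compat; lra].
        apply -> Rle_div_r; [|lra].
        replace (cbin (S n) * (PI / 2) * ((2 * INR n + 1) * cbin n))
          with ((INR n + 1) * cbin (S n) ^ 2 * PI) in H; [exact H|].
        rewrite !cbin_S. field. lra. }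
    pose proof (cbin_sq_le n) as H.
    assert (1 / (2 * INR n + 1) <= 1 / (INR n + 1)).
    { apply Rmult_le_compat_l; [lra|]. apply Rinv_le_contravar; lra. }
    nra.
Qed.

Lemma cbin_sq_lim : is_lim_seq (fun n => (INR n + 1 / 2) * cbin n ^ 2) (1 / PI).
Proof.
  apply is_lim_seq_le_le with
    (u := fun _ => 1 / PI) (w := fun n => 1 / PI + 1 / (INR n + 1)).
  - exact cbin_sq_bounds.
  - apply is_lim_seq_const.
  - replace (Finite (1 / PI)) with (Finite (1 / PI + 0)) by (f_equal; ring).
    apply is_lim_seq_plus'; [apply is_lim_seq_const|].
    apply is_lim_seq_const_div_S.
Qed.

(** * The differentiated WZ pair *)

Definition fact_ratio (n k : nat) : R :=
  INR (fact n) ^ 2 * INR (fact k) / INR (fact (k + 2 * n + 1)).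

(** The kernel h_x of the introduction at x = 0: each Gamma(m+1/2)/Gamma(m+1) is
    [sqrt PI * cbin m], and the unmatched factorials are in [fact_ratio]. *)
Definition kern (n k : nat) : R :=
  (-1) ^ n * cbin (k + n) ^ 3 * cbin n ^ 3 * cbin k * fact_ratio n k.

(** The derivative of ln h_x at x = 0, minus 4 ln 2.  The sums of the
    1/(j+1/2) over j < n are 2 H_(2n) - H_n; each digamma value has been
    replaced by its harmonic part, and the Euler constants cancel. *)
Definition kern_dlog (n k : nat) : R :=
  3 * (2 * harmonic (2 * n) - harmonic n)
  - 2 * (2 * harmonic (2 * k) - harmonic k)
  + 3 * harmonic (k + n) - harmonic (k + 2 * n + 1).

(** The certificate q_x at x = 0. *)
Definition cert (n k : nat) : R :=
  INR n * (2 * INR n + INR k + 1) * (2 * INR n + 2 * INR k + 1 / 2).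

(** The derivative of q_x at x = 0. *)
Definition dcert (n k : nat) : R := INR n * (INR k - 1 / 2).

Definition wzF (n k : nat) : R :=
  kern n k * (kern_dlog n k * cert n k + dcert n k).

Definition wzG (n k : nat) : R :=
  kern n k * (kern_dlog n k * ((INR n + INR k + 1 / 2) ^ 3 + cert n k)
              + dcert n k).

Lemma fact_ratio_pos (n k : nat) : 0 < fact_ratio n k.
Proof.
  unfold fact_ratio. pose proof (INR_fact_lt_0 n). pose proof (INR_fact_lt_0 k).
  apply Rdiv_lt_0_compat; [|apply INR_fact_lt_0].
  apply Rmult_lt_0_compat; [apply pow_lt|]; assumption.
Qed.

Lemma fact_ratio_S_r (n k : nat) :
  fact_ratio n (S k)
  = fact_ratio n k * ((INR k + 1) / (INR k + 2 * INR n + 2)).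
Proof.
  unfold fact_ratio.
  replace (S k + 2 * n + 1)%nat with (S (k + 2 * n + 1)) by lia.
  rewrite !fact_simpl, !mult_INR, !S_INR, !plus_INR, mult_INR.
  change (INR 2) with 2. change (INR 1) with 1.
  pose proof (pos_INR n). pose proof (pos_INR k).
  field. split; try lra; apply INR_fact_neq_0.
Qed.

Lemma fact_ratio_S_l (n k : nat) :
  fact_ratio (S n) k
  = fact_ratio n k * ((INR n + 1) ^ 2 /
      ((INR k + 2 * INR n + 2) * (INR k + 2 * INR n + 3))).
Proof.
  unfold fact_ratio.
  replace (k + 2 * S n + 1)%nat with (S (S (k + 2 * n + 1))) by lia.
  rewrite !fact_simpl, !mult_INR, !S_INR, !plus_INR, mult_INR.
  change (INR 2) with 2. change (INR 1) with 1.
  pose proof (pos_INR n). pose proof (pos_INR k).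
  field. repeat split; try lra; apply INR_fact_neq_0.
Qed.

Lemma odd_harmonic_S (n : nat) :
  2 * harmonic (2 * S n) - harmonic (S n)
  = 2 * harmonic (2 * n) - harmonic n + 2 / (2 * INR n + 1).
Proof.
  replace (2 * S n)%nat with (S (S (2 * n))) by lia.
  rewrite !harmonic_S, S_INR, mult_INR. change (INR 2) with 2.
  pose proof (pos_INR n). field. lra.
Qed.

Lemma kern_S_r (n k : nat) :
  kern n (S k)
  = kern n k * ((INR n + INR k + 1 / 2) ^ 3 * (INR k + 1 / 2) /
      ((INR n + INR k + 1) ^ 3 * (INR k + 2 * INR n + 2))).
Proof.
  unfold kern. rewrite fact_ratio_S_r. simpl Nat.add.
  rewrite !cbin_S, plus_INR.
  pose proof (pos_INR n). pose proof (pos_INR k). field. lra.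
Qed.

Lemma kern_S_l (n k : nat) :
  kern (S n) k
  = - kern n k * ((INR n + INR k + 1 / 2) ^ 3 * (INR n + 1 / 2) ^ 3 /
      ((INR n + INR k + 1) ^ 3 * (INR n + 1) *
       (INR k + 2 * INR n + 2) * (INR k + 2 * INR n + 3))).
Proof.
  unfold kern. rewrite fact_ratio_S_l, Nat.add_succ_r.
  rewrite !cbin_S, plus_INR. simpl pow.
  pose proof (pos_INR n). pose proof (pos_INR k). field. lra.
Qed.

Lemma kern_dlog_S_r (n k : nat) :
  kern_dlog n (S k)
  = kern_dlog n k - 2 / (INR k + 1 / 2) + 3 / (INR n + INR k + 1)
    - 1 / (INR k + 2 * INR n + 2).
Proof.
  unfold kern_dlog. rewrite odd_harmonic_S. rewrite !Nat.add_succ_l.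
  rewrite !harmonic_S, !plus_INR, mult_INR.
  change (INR 2) with 2. change (INR 1) with 1.
  pose proof (pos_INR n). pose proof (pos_INR k). field. lra.
Qed.

Lemma kern_dlog_S_l (n k : nat) :
  kern_dlog (S n) k
  = kern_dlog n k + 3 / (INR n + 1 / 2) + 3 / (INR n + INR k + 1)
    - 1 / (INR k + 2 * INR n + 2) - 1 / (INR k + 2 * INR n + 3).
Proof.
  unfold kern_dlog. rewrite odd_harmonic_S, Nat.add_succ_r.
  replace (k + 2 * S n + 1)%nat with (S (S (k + 2 * n + 1))) by lia.
  rewrite !harmonic_S, !S_INR, !plus_INR, mult_INR.
  change (INR 2) with 2. change (INR 1) with 1.
  pose proof (pos_INR n). pose proof (pos_INR k). field. lra.
Qed.

(** After division by [kern n k] both sides are affine in [kern_dlog n k] over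
    the rational functions of n and k: the coefficient of [kern_dlog n k] is the
    pair relation for F_0, G_0, and the rest is its x-derivative at 0. *)
Lemma wz_equation (n k : nat) :
  wzG n (S k) - wzG n k = wzF (S n) k - wzF n k.
Proof.
  unfold wzG, wzF, cert, dcert.
  rewrite kern_S_r, kern_S_l, kern_dlog_S_r, kern_dlog_S_l, !S_INR.
  pose proof (pos_INR n). pose proof (pos_INR k). field. lra.
Qed.

Lemma sum_wzG_S (N k : nat) :
  sum_n (fun n => wzG n (S k)) N - sum_n (fun n => wzG n k) N = wzF (S N) k.
Proof.
  induction N as [|N IH].
  - rewrite !sum_O, wz_equation.
    replace (wzF 0 k) with 0; [ring|].
    unfold wzF, cert, dcert. simpl INR. ring.
  - rewrite !sum_Sn. unfold plus; simpl.
    pose proof (wz_equation (S N) k). lra.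
Qed.

(** * Uniform geometric bounds *)

Lemma kern_dlog_le (n k : nat) :
  Rabs (kern_dlog n k) <= 15 * (INR n + INR k + 1).
Proof.
  unfold kern_dlog.
  pose proof (harmonic_bounds (2 * n)) as H1.
  pose proof (harmonic_bounds n) as H2.
  pose proof (harmonic_bounds (2 * k)) as H3.
  pose proof (harmonic_bounds k) as H4.
  pose proof (harmonic_bounds (k + n)) as H5.
  pose proof (harmonic_bounds (k + 2 * n + 1)) as H6.
  rewrite ?plus_INR, ?mult_INR in *.
  change (INR 2) with 2 in *. change (INR 1) with 1 in *.
  apply Rabs_le. lra.
Qed.

(** For n >= 1, a step n -> n+1 multiplies (n+k+1)^3 by at most (3/2)^3 and
    [fact_ratio] by at most 1/4; their product 27/32 is below 1.  At n = 0
    the product of the two is (k+1)^2, which is unbounded in k, hence the start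
    at [S n]. *)
Lemma fact_ratio_geom (n k : nat) :
  (INR n + INR k + 2) ^ 3 * fact_ratio (S n) k <= 4 / 3 * (27 / 32) ^ n.
Proof.
  pose proof (pos_INR k) as Hk. induction n as [|n IH].
  - assert (E : fact_ratio 1 k
                = 1 / ((INR k + 1) * (INR k + 2) * (INR k + 3))).
    { rewrite fact_ratio_S_l. unfold fact_ratio.
      replace (k + 2 * 0 + 1)%nat with (S k) by lia.
      rewrite fact_simpl, mult_INR, S_INR. simpl.
      field. repeat split; try lra; apply INR_fact_neq_0. }
    rewrite E. simpl INR. simpl ((27 / 32) ^ 0).
    replace ((0 + INR k + 2) ^ 3 *
             (1 / ((INR k + 1) * (INR k + 2) * (INR k + 3))))
      with ((INR k + 2) ^ 2 / ((INR k + 1) * (INR k + 3))) by (field; lra).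
    apply <- Rle_div_l; nra.
  - rewrite fact_ratio_S_l, S_INR. pose proof (pos_INR n) as Hn.
    pose proof (fact_ratio_pos (S n) k) as Hu.
    set (u := fact_ratio (S n) k) in *.
    set (a := INR n) in *. set (b := INR k) in *.
    replace ((a + 1 + b + 2) ^ 3 *
       (u * ((a + 1 + 1) ^ 2 /
             ((b + 2 * (a + 1) + 2) * (b + 2 * (a + 1) + 3)))))
      with (((a + b + 3) / (a + b + 2)) ^ 3 *
            ((a + 2) ^ 2 / ((b + 2 * a + 4) * (b + 2 * a + 5))) *
            ((a + b + 2) ^ 3 * u)) by (field; lra).
    assert (H1 : 0 <= (a + b + 3) / (a + b + 2) <= 3 / 2).
    { split; [apply Rlt_le, Rdiv_lt_0_compat; lra|].
      apply <- Rle_div_l; lra. }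
    assert (H2 : 0 <= (a + 2) ^ 2 / ((b + 2 * a + 4) * (b + 2 * a + 5)) <= 1 / 4).
    { split; [apply Rlt_le, Rdiv_lt_0_compat; nra|].
      apply <- Rle_div_l; nra. }
    assert (H3 : ((a + b + 3) / (a + b + 2)) ^ 3 <= (3 / 2) ^ 3)
      by (apply pow_incr; assumption).
    assert (H4 : 0 <= ((a + b + 3) / (a + b + 2)) ^ 3)
      by (apply pow_le; lra).
    assert (H5 : 0 <= (a + b + 2) ^ 3 * u).
    { apply Rmult_le_pos; [apply pow_le|]; lra. }
    replace (4 / 3 * (27 / 32) ^ S n)
      with ((3 / 2) ^ 3 * (1 / 4) * (4 / 3 * (27 / 32) ^ n)) by (simpl; field).
    apply Rmult_le_compat; [apply Rmult_le_pos; lra|assumption| |assumption].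
    apply Rmult_le_compat; lra.
Qed.

(** [cbin (k+n)^2] absorbs
    one power of n+k+1, and [cbin (k+n) * cbin k <= cbin k ^ 2] yields the power
    of k+1 that makes the sum over n >= 1 vanish as k grows. *)
Lemma kern_le (n k : nat) :
  (INR n + INR k + 1) * (INR k + 1) * Rabs (kern n k) <= fact_ratio n k.
Proof.
  pose proof (pos_INR n) as Hn. pose proof (pos_INR k) as Hk.
  pose proof (fact_ratio_pos n k) as Hu.
  assert (c1 : forall m, 0 <= cbin m <= 1).
  { intros m. pose proof (cbin_pos m). pose proof (cbin_add_le 0 m) as H0.
    rewrite cbin_0 in H0. simpl in H0. lra. }
  assert (E : Rabs (kern n k)
              = cbin (k + n) ^ 2 * (cbin (k + n) * cbin k)
                * cbin n ^ 3 * fact_ratio n k).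
  { unfold kern. rewrite !Rabs_mult, pow_1_abs.
    rewrite <- !RPow_abs.
    rewrite (Rabs_pos_eq (cbin (k + n))), (Rabs_pos_eq (cbin n)),
      (Rabs_pos_eq (cbin k)), (Rabs_pos_eq (fact_ratio n k));
      try apply c1; [ring|lra]. }
  rewrite E.
  assert (H1 : (INR n + INR k + 1) * cbin (k + n) ^ 2 <= 1).
  { pose proof (cbin_sq_le (k + n)) as H. rewrite plus_INR in H.
    apply (Rle_div_r (cbin (k + n) ^ 2) 1) in H; [|lra].
    pose proof (pow2_ge_0 (cbin (k + n))). nra. }
  assert (H2 : (INR k + 1) * (cbin (k + n) * cbin k) <= 1).
  { pose proof (cbin_sq_le k) as H.
    apply (Rle_div_r (cbin k ^ 2) 1) in H; [|lra].
    pose proof (pow2_ge_0 (cbin k)).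
    pose proof (cbin_add_le k n). pose proof (cbin_pos k).
    assert (cbin (k + n) * cbin k <= cbin k ^ 2) by nra.
    nra. }
  assert (H3 : cbin n ^ 3 <= 1).
  { rewrite <- (pow1 3). apply pow_incr, c1. }
  assert (P1 : 0 <= (INR n + INR k + 1) * cbin (k + n) ^ 2).
  { apply Rmult_le_pos; [lra|apply pow2_ge_0]. }
  assert (P2 : 0 <= (INR k + 1) * (cbin (k + n) * cbin k)).
  { apply Rmult_le_pos; [lra|apply Rmult_le_pos; apply c1]. }
  assert (P3 : 0 <= cbin n ^ 3) by apply pow_le, c1.
  replace ((INR n + INR k + 1) * (INR k + 1) *
     (cbin (k + n) ^ 2 * (cbin (k + n) * cbin k) * cbin n ^ 3 * fact_ratio n k))
    with ((INR n + INR k + 1) * cbin (k + n) ^ 2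
          * ((INR k + 1) * (cbin (k + n) * cbin k)) * cbin n ^ 3
          * fact_ratio n k) by ring.
  rewrite <- (Rmult_1_l (fact_ratio n k)) at 2.
  apply Rmult_le_compat_r; [lra|].
  apply Rle_trans with (1 * 1 * 1); [|lra].
  repeat apply Rmult_le_compat; trivial. apply Rmult_le_pos; trivial.
Qed.

(** The common bound for [wzF] and [wzG], which differ only in the cubic
    polynomial [p].  The harmonic part grows at most linearly, so the bracket is
    O((n+k+2)^4); [kern_le] takes care of one of these powers and
    [fact_ratio_geom] of the other three. *)
Lemma kern_poly_le (n k : nat) (p : R) :
  0 <= p <= 5 * (INR n + INR k + 2) ^ 3 ->
  Rabs (kern (S n) k * (kern_dlog (S n) k * p + dcert (S n) k))
  <= 102 / (INR k + 1) * (27 / 32) ^ n.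
Proof.
  intros Hp. pose proof (pos_INR n) as Hn. pose proof (pos_INR k) as Hk.
  pose proof (kern_dlog_le (S n) k) as HL.
  pose proof (kern_le (S n) k) as HK.
  pose proof (fact_ratio_geom n k) as HG.
  unfold dcert. rewrite S_INR in *.
  replace (INR n + 1 + INR k + 1) with (INR n + INR k + 2) in * by ring.
  set (m := INR n + INR k + 2) in *.
  assert (Hd : Rabs ((INR n + 1) * (INR k - 1 / 2)) <= m ^ 2).
  { apply Rabs_le. unfold m. nra. }
  assert (Hm : 2 <= m) by (unfold m; lra).
  assert (HLp : Rabs (kern_dlog (S n) k * p + (INR n + 1) * (INR k - 1 / 2))
                <= 76 * m ^ 4).
  { eapply Rle_trans; [apply Rabs_triang|].
    rewrite Rabs_mult, (Rabs_pos_eq p) by apply Hp.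
    assert (Rabs (kern_dlog (S n) k) * p <= 15 * m * (5 * m ^ 3)).
    { apply Rmult_le_compat; try apply Hp; [apply Rabs_pos|exact HL]. }
    assert (m ^ 2 <= m ^ 4) by (apply Rle_pow; [lra|lia]).
    replace (76 * m ^ 4) with (15 * m * (5 * m ^ 3) + m ^ 4) by ring. lra. }
  rewrite Rabs_mult.
  assert (Hh := Rabs_pos (kern (S n) k)).
  set (h := Rabs (kern (S n) k)) in *.
  apply Rle_trans with (h * (76 * m ^ 4)).
  { apply Rmult_le_compat_l; assumption. }
  apply Rle_trans with (76 / (INR k + 1) * (m ^ 3 * fact_ratio (S n) k)).
  { replace (h * (76 * m ^ 4))
      with (76 / (INR k + 1) * (m ^ 3 * (m * (INR k + 1) * h)))
      by (field; lra).
    apply Rmult_le_compat_l; [apply Rlt_le, Rdiv_lt_0_compat; lra|].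
    apply Rmult_le_compat_l; [apply pow_le; lra|exact HK]. }
  assert (H76 : 0 < 76 / (INR k + 1)) by (apply Rdiv_lt_0_compat; lra).
  apply Rle_trans with (76 / (INR k + 1) * (4 / 3 * (27 / 32) ^ n)).
  { apply Rmult_le_compat_l; lra. }
  assert (Hg : 0 < (27 / 32) ^ n) by (apply pow_lt; lra).
  replace (102 / (INR k + 1) * (27 / 32) ^ n)
    with (76 / (INR k + 1) * (102 / 76 * (27 / 32) ^ n)) by (field; lra).
  apply Rmult_le_compat_l; lra.
Qed.

Lemma cert_bounds (n k : nat) :
  0 <= cert n k <= 4 * (INR n + INR k + 1) ^ 3.
Proof.
  unfold cert. pose proof (pos_INR n). pose proof (pos_INR k). split.
  - repeat apply Rmult_le_pos; lra.
  - replace (4 * (INR n + INR k + 1) ^ 3)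
      with ((INR n + INR k + 1) * (2 * (INR n + INR k + 1))
            * (2 * (INR n + INR k + 1))) by ring.
    apply Rmult_le_compat; [apply Rmult_le_pos; lra|lra| |lra].
    apply Rmult_le_compat; lra.
Qed.

Lemma wzF_le (n k : nat) :
  Rabs (wzF (S n) k) <= 102 / (INR k + 1) * (27 / 32) ^ n.
Proof.
  apply kern_poly_le. pose proof (cert_bounds (S n) k) as H.
  rewrite S_INR in H.
  replace (INR n + 1 + INR k + 1) with (INR n + INR k + 2) in H by ring.
  pose proof (pos_INR n). pose proof (pos_INR k).
  assert (0 <= (INR n + INR k + 2) ^ 3) by (apply pow_le; lra). lra.
Qed.

Lemma wzG_le (n k : nat) :
  Rabs (wzG (S n) k) <= 102 / (INR k + 1) * (27 / 32) ^ n.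
Proof.
  apply kern_poly_le. pose proof (cert_bounds (S n) k) as H.
  rewrite S_INR in *.
  replace (INR n + 1 + INR k + 1) with (INR n + INR k + 2) in H by ring.
  pose proof (pos_INR n). pose proof (pos_INR k).
  assert (0 <= (INR n + 1 + INR k + 1 / 2) ^ 3 <= (INR n + INR k + 2) ^ 3).
  { split; [apply pow_le; lra|apply pow_incr; lra]. }
  lra.
Qed.

(** * Summation over n and the limit in k *)

Lemma is_series_geom_scal (c : R) :
  is_series (fun n => c * (27 / 32) ^ n) (32 / 5 * c).
Proof.
  replace (32 / 5 * c) with (scal c (/ (1 - 27 / 32)))
    by (unfold scal; simpl; unfold mult; simpl; field).
  apply (is_series_scal (V := R_NormedModule)). apply is_series_geom.
  rewrite Rabs_pos_eq; lra.
Qed.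

Lemma ex_series_wzG (k : nat) : ex_series (fun n => wzG n k).
Proof.
  apply ex_series_incr_1.
  apply (ex_series_le (V := R_CompleteNormedModule))
    with (b := fun n => 102 / (INR k + 1) * (27 / 32) ^ n).
  - intros n. apply wzG_le.
  - eexists. apply is_series_geom_scal.
Qed.

(** The partial sums differ by the boundary term [wzF (S N) k], which tends
    to 0. *)
Lemma Series_wzG_S (k : nat) :
  Series (fun n => wzG n (S k)) = Series (fun n => wzG n k).
Proof.
  apply Rminus_diag_uniq.
  assert (H1 : is_lim_seq (fun N => wzF (S N) k)
            (Series (fun n => wzG n (S k)) - Series (fun n => wzG n k))).
  { apply is_lim_seq_ext with
      (fun N => sum_n (fun n => wzG n (S k)) N - sum_n (fun n => wzG n k) N).
    { intros N. apply sum_wzG_S. }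
    apply is_lim_seq_minus';
      apply (Series_correct (fun n => wzG n _)), ex_series_wzG. }
  assert (H2 : is_lim_seq (fun N => wzF (S N) k) 0).
  { apply is_lim_seq_abs_0.
    apply is_lim_seq_le_le with (u := fun _ => 0)
      (w := fun n => 102 / (INR k + 1) * (27 / 32) ^ n).
    - intros n. split; [apply Rabs_pos|apply wzF_le].
    - apply is_lim_seq_const.
    - replace (Finite 0) with (Rbar_mult (102 / (INR k + 1)) 0)
        by (simpl; f_equal; ring).
      apply is_lim_seq_scal_l, is_lim_seq_geom. rewrite Rabs_pos_eq; lra. }
  apply is_lim_seq_unique in H1. apply is_lim_seq_unique in H2.
  rewrite H1 in H2. injection H2. trivial.
Qed.

Lemma Series_wzG_near_0 (k : nat) :
  Rabs (Series (fun n => wzG n k) - wzG 0 k) <= 32 / 5 * (102 / (INR k + 1)).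
Proof.
  rewrite Series_incr_1 by apply ex_series_wzG.
  replace (wzG 0 k + Series (fun n => wzG (S n) k) - wzG 0 k)
    with (Series (fun n => wzG (S n) k)) by ring.
  assert (Hs := is_series_geom_scal (102 / (INR k + 1))).
  eapply Rle_trans.
  { apply Series_Rabs.
    apply (ex_series_le (V := R_CompleteNormedModule))
      with (b := fun n => 102 / (INR k + 1) * (27 / 32) ^ n).
    - intros n. unfold norm; simpl. unfold abs; simpl.
      rewrite Rabs_Rabsolu. apply wzG_le.
    - eexists; exact Hs. }
  eapply Rle_trans.
  { apply Series_le with (b := fun n => 102 / (INR k + 1) * (27 / 32) ^ n).
    - intros n. split; [apply Rabs_pos|apply wzG_le].
    - eexists; exact Hs. }
  rewrite (is_series_unique _ _ Hs). lra.
Qed.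

Lemma wzG_0_l (k : nat) :
  wzG 0 k
  = ((INR k + 1 / 2) * cbin k ^ 2) * ((INR k + 1 / 2) * cbin k ^ 2)
    * (1 - 1 / 2 / (INR k + 1))
    * (-4 * (harmonic (2 * k) - harmonic k) - 1 / (INR k + 1)).
Proof.
  unfold wzG, kern, kern_dlog, cert, dcert, fact_ratio.
  replace (k + 2 * 0 + 1)%nat with (S k) by lia.
  rewrite Nat.add_0_r, Nat.mul_0_r, harmonic_S, harmonic_0, cbin_0.
  rewrite fact_simpl, mult_INR, S_INR. simpl (INR (fact 0)). simpl (INR 0).
  pose proof (pos_INR k). field. split; try lra; apply INR_fact_neq_0.
Qed.

(** The value -4 ln 2 / PI^2 is the trace of the constant 4 ln 2 removed from the
    logarithmic derivative: the full derivative of G_x(0,k) tends to 0. *)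
Lemma wzG_0_lim : is_lim_seq (wzG 0) (- (4 * ln 2 / PI ^ 2)).
Proof.
  eapply is_lim_seq_ext; [intros k; symmetry; apply wzG_0_l|].
  pose proof PI_RGT_0.
  replace (Finite (- (4 * ln 2 / PI ^ 2)))
    with (Finite (1 / PI * (1 / PI) * (1 - 0) * (-4 * ln 2 - 0)))
    by (f_equal; field; lra).
  apply is_lim_seq_mult'; [apply is_lim_seq_mult'|].
  - apply is_lim_seq_mult'; exact cbin_sq_lim.
  - apply is_lim_seq_minus'; [apply is_lim_seq_const|].
    apply is_lim_seq_const_div_S.
  - apply is_lim_seq_minus'; [|apply is_lim_seq_const_div_S].
    apply (is_lim_seq_scal_l _ (-4) (ln 2)). exact harmonic_2n_sub_n_lim.
Qed.

Lemma Series_wzG_0 : Series (fun n => wzG n 0) = - (4 * ln 2 / PI ^ 2).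
Proof.
  assert (E : forall k, Series (fun n => wzG n k) = Series (fun n => wzG n 0)).
  { induction k as [|k IH]; [reflexivity|]. rewrite Series_wzG_S. exact IH. }
  set (s := Series (fun n => wzG n 0)) in *.
  assert (H : is_lim_seq (fun k => s - wzG 0 k) 0).
  { apply is_lim_seq_abs_0.
    apply is_lim_seq_le_le with (u := fun _ => 0)
      (w := fun k => 32 / 5 * (102 / (INR k + 1))).
    - intros k. split; [apply Rabs_pos|]. rewrite <- (E k).
      apply Series_wzG_near_0.
    - apply is_lim_seq_const.
    - replace (Finite 0) with (Rbar_mult (32 / 5) 0)
        by (simpl; f_equal; ring).
      apply is_lim_seq_scal_l, is_lim_seq_const_div_S. }
  assert (H' := is_lim_seq_minus' _ _ _ _ (is_lim_seq_const s) wzG_0_lim).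
  apply is_lim_seq_unique in H. apply is_lim_seq_unique in H'.
  rewrite H in H'.
  assert (E0 : 0 = s - - (4 * ln 2 / PI ^ 2)) by (injection H'; trivial).
  lra.
Qed.

Lemma fact_ratio_0_r (n : nat) :
  cbin n * fact_ratio n 0 = (1 / 4) ^ n / (2 * INR n + 1).
Proof.
  unfold cbin, Binomial.C, fact_ratio.
  replace (2 * n - n)%nat with n by lia.
  replace (0 + 2 * n + 1)%nat with (S (2 * n)) by lia.
  rewrite (fact_simpl (2 * n)), mult_INR, S_INR, mult_INR.
  change (INR 2) with 2. simpl (INR (fact 0)).
  replace ((1 / 4) ^ n) with (/ 4 ^ n)
    by (unfold Rdiv; rewrite Rmult_1_l; symmetry; apply pow_inv).
  pose proof (pos_INR n).
  field. repeat split; try apply INR_fact_neq_0; [apply pow_nonzero; lra|lra].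
Qed.

(** At k = 0 the numbers H_n cancel in [kern_dlog], which becomes
    5 H_(2n) - 1/(2n+1); the cubic factors as (2n+1)(20n^2+8n+1)/8, and 2n+1 is
    the surplus factor in the denominator of [fact_ratio n 0]. *)
Lemma summand_eq_wzG (n : nat) :
  (Binomial.C (2 * n) n) ^ 5 / (- (2 ^ 12)) ^ n
  * (5 * (20 * (INR n) ^ 2 + 8 * INR n + 1) * harmonic (2 * n)
     - 10 * INR n - 1)
  = 8 * wzG n 0.
Proof.
  assert (E : Binomial.C (2 * n) n ^ 5 / (- (2 ^ 12)) ^ n
              = (-1) ^ n * cbin n ^ 5 * (1 / 4) ^ n).
  { unfold cbin.
    replace (- 2 ^ 12) with (-1 * (4 ^ 5 * 4)) by ring.
    rewrite !Rpow_mult_distr.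
    replace ((1 / 4) ^ n) with (/ 4 ^ n)
      by (unfold Rdiv; rewrite Rmult_1_l; symmetry; apply pow_inv).
    rewrite <- !pow_mult, (Nat.mul_comm 5 n), pow_mult.
    assert (4 ^ n <> 0) by (apply pow_nonzero; lra).
    assert ((-1) ^ n * (-1) ^ n = 1).
    { rewrite <- Rpow_mult_distr. replace (-1 * -1) with 1 by ring. apply pow1. }
    assert ((-1) ^ n <> 0) by (apply pow_nonzero; lra).
    apply Rmult_eq_reg_l with ((-1) ^ n); [|assumption].
    transitivity (Binomial.C (2 * n) n ^ 5 / ((4 ^ n) ^ 5 * 4 ^ n));
      [field; split; assumption|].
    (* (-1)^n is its own inverse *)
    transitivity ((-1) ^ n * (-1) ^ n
                  * (Binomial.C (2 * n) n ^ 5 / ((4 ^ n) ^ 5 * 4 ^ n)));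
      [rewrite H0; ring|field; assumption]. }
  rewrite E.
  assert (K : kern n 0 = (-1) ^ n * cbin n ^ 5 * (1 / 4) ^ n / (2 * INR n + 1)).
  { unfold kern. rewrite cbin_0, Nat.add_0_l.
    transitivity ((-1) ^ n * cbin n ^ 5 * (cbin n * fact_ratio n 0)); [ring|].
    rewrite fact_ratio_0_r. unfold Rdiv. ring. }
  unfold wzG. rewrite K. unfold kern_dlog, cert, dcert.
  replace (0 + 2 * n + 1)%nat with (S (2 * n)) by lia.
  rewrite Nat.mul_0_r, Nat.add_0_l, harmonic_S, harmonic_0, mult_INR.
  change (INR 2) with 2. simpl (INR 0).
  pose proof (pos_INR n). field. lra.
Qed.

Theorem theorem1p6 :
  is_series
    (fun k : nat =>
       (Binomial.C (2 * k) k) ^ 5 / (- (2 ^ 12)) ^ k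
       * (5 * (20 * (INR k) ^ 2 + 8 * INR k + 1) * harmonic (2 * k)
          - 10 * INR k - 1))
    (- (32 * ln 2 / PI ^ 2)).
Proof.
  apply is_series_ext with (fun n => 8 * wzG n 0).
  { intros n. symmetry. apply summand_eq_wzG. }
  replace (- (32 * ln 2 / PI ^ 2)) with (scal 8 (- (4 * ln 2 / PI ^ 2)))
    by (unfold scal; simpl; unfold mult; simpl; field; apply PI_neq0).
  apply (is_series_scal (V := R_NormedModule)).
  rewrite <- Series_wzG_0. apply Series_correct, ex_series_wzG.
Qed.
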